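(* Assume that condition $\mathcal S^{(1)}(r_n,u_n)$ holds. Then $$\lim_{n\to\infty}\frac{P(A_1\cap A_2)}{w_n}=\vartheta\,E[\mathcal L(Z)-1].$$
   Context: Fix $d\ge1$, a norm $|\cdot|$ on $\mathbb R^d$, and a stationary regularly varying $\mathbb R^d$-valued time series $X=(X_j)_{j\in\mathbb Z}$ with tail index $\alpha>0$: there is a process $Y=(Y_j)_{j\in\mathbb Z}$ (the tail process) such that for all $i\le j$ the law of $x^{-1}(X_i,\dots,X_j)$ given $|X_0|>x$ converges weakly to the law of $(Y_i,\dots,Y_j)$ as $x\to\infty$. $u_n>0$, $r_n\in\mathbb N$, $w_n=P(|X_0|>u_n)$, with $u_n,r_n,nw_n\to\infty$, $r_n/n\to0$, $r_nw_n\to0$. $x^*_{i,j}=\max_{i\le l\le j}|x_l|$. For a sequence $x=(x_j)_{j\in\mathbb Z}$ in $\mathbb R^d$ tending to zero as $|j|\to\infty$, the cluster length is $\mathcal L(x)=\sup\{j:|x_j|>1\}-\inf\{j:|x_j|>1\}+1$, and $\mathcal L(x)=0$ if $\sup_j|x_j|\le1$. $A_j=\{X^*_{(j-1)r_n+1,jr_n}>u_n\}$. $\vartheta=P(Y^*_{-\infty,-1}\le1)$, and $Z$ has the law of $Y$ conditioned on $Y^*_{-\infty,-1}\le1$. Condition $\mathcal S^{(\kappa)}(r_n,u_n)$: for all $s,t>0$, $\lim_{\ell\to\infty}\limsup_{n\to\infty}\frac1{w_n}\sum_{i=\ell}^{r_n}i^\kappa P(|X_0|>u_ns,|X_i|>u_nt)=0$;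 by convention it is understood to hold also with $r_n$ replaced by $cr_n$ for constants $c>1$. (It implies $Y_j\to0$ a.s. as $|j|\to\infty$ and $\vartheta>0$.) *)

(* Defs.v *)
From mathcomp Require Export all_boot all_order all_algebra.
From mathcomp Require Export all_classical all_reals all_analysis.
Export Order.TTheory GRing.Theory Num.Theory.
Export numFieldNormedType.Exports.

Set Implicit Arguments.
Unset Strict Implicit.
Unset Printing Implicit Defensive.

Local Open Scope classical_set_scope.
Local Open Scope ring_scope.

(* A point of R^d is a row vector, a time series is a family
   [X : int -> T -> 'rV[R]_d], and its sample path at [t] is [X ^~ t]. *)

Record is_norm (R : realType) (d : nat) (N : 'rV[R]_d -> R) : Prop := IsNorm {
  norm_separating : forall x, N x = 0 -> x = 0 ;
  norm_homogeneous : forall (a : R) x, N (a *: x) = `|a| * N x ;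
  norm_subadditive : forall x y, N (x + y) <= N x + N y }.

Definition prob (R : realType) (d : measure_display) (T : measurableType d)
  (P : probability T R) (A : set T) : R := fine (P A).

Definition is_process (R : realType) (d : nat) (dT : measure_display)
    (T : measurableType dT) (X : int -> T -> 'rV[R]_d) : Prop :=
  forall j, measurable_fun [set: T]
    (X j : T -> g_sigma_algebraType (@open 'rV[R]_d)).

(* The stretch (x_i, ..., x_(i+k)), an element of (R^d)^(k+1), as the matrix
   having these vectors as its rows. *)
Definition block (R : realType) (d : nat) (x : int -> 'rV[R]_d)
    (i : int) (k : nat) : 'M[R]_(k.+1, d) :=
  \matrix_(l < k.+1, c < d) x (i + (l : nat)%:Z) 0 c.

Definition stationary (R : realType) (d : nat) (dT : measure_display)
    (T : measurableType dT) (P : probability T R)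
    (X : int -> T -> 'rV[R]_d) : Prop :=
  forall (h i : int) (k : nat) (B : set 'M[R]_(k.+1, d)),
    <<s @open 'M[R]_(k.+1, d) >> B ->
    P [set t | B (block (X ^~ t) (i + h) k)] = P [set t | B (block (X ^~ t) i k)].

Definition exceeds (R : realType) (d : nat) (N : 'rV[R]_d -> R)
    (dT : measure_display) (T : measurableType dT)
    (X : int -> T -> 'rV[R]_d) (j : int) (x : R) : set T :=
  [set t | x < N (X j t)].

(* |X_0| is unbounded and has a regularly varying tail of index -alpha. *)
Definition tail_index (R : realType) (d : nat) (N : 'rV[R]_d -> R)
    (dT : measure_display) (T : measurableType dT) (P : probability T R)
    (X : int -> T -> 'rV[R]_d) (alpha : R) : Prop :=
  (forall x : R, 0 < prob P (exceeds N X 0 x)) /\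
  (forall y : R, 0 < y ->
    prob P (exceeds N X 0 (x * y)) / prob P (exceeds N X 0 x)
      @[x --> +oo] --> y `^ (- alpha)).

(* Weak convergence, tested on bounded continuous functions, of the law of
   x^-1 (X_i, ..., X_(i+k)) given |X_0| > x to the law of (Y_i, ..., Y_(i+k)). *)
Definition tail_process (R : realType) (d : nat) (N : 'rV[R]_d -> R)
    (dT : measure_display) (T : measurableType dT) (P : probability T R)
    (X : int -> T -> 'rV[R]_d)
    (dY : measure_display) (TY : measurableType dY) (PY : probability TY R)
    (Y : int -> TY -> 'rV[R]_d) : Prop :=
  is_process Y /\
  forall (i : int) (k : nat) (f : 'M[R]_(k.+1, d) -> R),
    continuous f -> (exists M : R, forall m, `|f m| <= M) ->
    (\int[P]_(t in exceeds N X 0 x) f (x^-1 *: block (X ^~ t) i k))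
      / prob P (exceeds N X 0 x)
      @[x --> +oo] --> \int[PY]_(t in [set: TY]) f (block (Y ^~ t) i k).

(* The supremum of |x_l| over l in I; it is -oo when I is empty. *)
Definition max_norm (R : realType) (d : nat) (N : 'rV[R]_d -> R)
    (x : int -> 'rV[R]_d) (I : set int) : \bar R :=
  ereal_sup [set (N (x l))%:E | l in I].

(* Extended-real valued so as to be total: the value is finite at every
   sequence tending to zero, and +oo when infinitely many |x_j| exceed 1. *)
Definition cluster_length (R : realType) (d : nat) (N : 'rV[R]_d -> R)
    (x : int -> 'rV[R]_d) : \bar R :=
  let J := [set (j%:~R : R)%:E | j in [set j : int | 1 < N (x j)]] in
  if pselect (J = set0) then 0%E else (ereal_sup J - ereal_inf J + 1)%E.

Definition block_exceeds (R : realType) (d : nat) (N : 'rV[R]_d -> R)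
    (dT : measure_display) (T : measurableType dT)
    (X : int -> T -> 'rV[R]_d) (r : nat -> nat) (u : nat -> R)
    (j : int) (n : nat) : set T :=
  [set t | ((u n)%:E < max_norm N (X ^~ t)
     [set l : int | ((j - 1) * (r n)%:Z + 1 <= l <= j * (r n)%:Z)%R])%E].

Definition no_past_exceedance (R : realType) (d : nat) (N : 'rV[R]_d -> R)
    (dT : measure_display) (T : measurableType dT)
    (Y : int -> T -> 'rV[R]_d) : set T :=
  [set t | (max_norm N (Y ^~ t) [set l : int | (l <= -1)%R] <= 1)%E].

Definition theta (R : realType) (d : nat) (N : 'rV[R]_d -> R)
    (dY : measure_display) (TY : measurableType dY) (PY : probability TY R)
    (Y : int -> TY -> 'rV[R]_d) : R :=
  prob PY (no_past_exceedance N Y).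

(* The product sigma-algebra on (R^d)^Z. *)
Definition path_measurable (R : realType) (d : nat)
    (C : set (int -> 'rV[R]_d)) : Prop :=
  <<s [set D | exists (j : int) (B : set 'rV[R]_d),
        <<s @open 'rV[R]_d >> B /\ D = [set x | B (x j)]] >> C.

(* Z has the law of Y conditioned on its past staying in the unit ball.  In
   the multiplied-out form P(E) P(Z in C) = P(Y in C, E) the definition does
   not itself presuppose P(E) > 0. *)
Definition conditioned_tail_process (R : realType) (d : nat)
    (N : 'rV[R]_d -> R)
    (dY : measure_display) (TY : measurableType dY) (PY : probability TY R)
    (Y : int -> TY -> 'rV[R]_d)
    (dZ : measure_display) (TZ : measurableType dZ) (PZ : probability TZ R)
    (Z : int -> TZ -> 'rV[R]_d) : Prop :=
  is_process Z /\
  forall C : set (int -> 'rV[R]_d), path_measurable C ->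
    theta N PY Y * prob PZ [set t | C (Z ^~ t)] =
    prob PY ([set t | C (Y ^~ t)] `&` no_past_exceedance N Y).

Definition condS_at (R : realType) (d : nat) (N : 'rV[R]_d -> R)
    (dT : measure_display) (T : measurableType dT) (P : probability T R)
    (X : int -> T -> 'rV[R]_d) (kappa : R) (r : nat -> nat) (u : nat -> R)
    : Prop :=
  forall s t : R, 0 < s -> 0 < t ->
    limn_esup (fun n : nat =>
      ((prob P (exceeds N X 0 (u n)))^-1 *
        \sum_(l <= i < (r n).+1) i%:R `^ kappa *
           prob P (exceeds N X 0 (u n * s) `&` exceeds N X i%:Z (u n * t)))%:E)
      @[l --> \oo] --> (0 : \bar R)%E.

(* The usual convention: the condition is also imposed with r_n replaced by
   (the integer part of) c r_n, for every constant c > 1. *)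
Definition condS (R : realType) (d : nat) (N : 'rV[R]_d -> R)
    (dT : measure_display) (T : measurableType dT) (P : probability T R)
    (X : int -> T -> 'rV[R]_d) (kappa : R) (r : nat -> nat) (u : nat -> R)
    : Prop :=
  condS_at N P X kappa r u /\
  forall c : R, 1 < c ->
    condS_at N P X kappa (fun n => Num.truncn (c * (r n)%:R)) u.

(* Main.v *)
Require Import Defs.
From mathcomp Require Import measurable_realfun zify ring lra.

(* A_1 and A_2 both occur iff there is a first exceedance at some time i of the
   first block and another exceedance in the second one.  Shifting time i to 0
   by stationarity and writing k = r_n + 1 - i,
     P(A_1, A_2) / w_n = sum_(1 <= k <= r_n) a_n(k),
   where a_n(k) is the conditional probability, given |X_0| > u_n, of no
   exceedance in [k - r_n, -1] and some exceedance in [k, k + r_n - 1].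
   Weak convergence to the tail process handles finite time windows, and
   condition S^(1), used with 2 r_n, bounds both the error of truncating the
   windows and the tail of the sum over k, because
     sum_(k >= K) a_n(k) <= sum_(j >= K) j P(|X_0| > u_n, |X_j| > u_n) / w_n.
   Hence the limit is the sum over k >= 1 of the probabilities that Y has no
   exceedance before time 0 and some exceedance at or after time k.  As
   L(Z) - 1 is the time of the last exceedance of Z, this is the tail-sum
   formula for theta E[L(Z) - 1]. *)

Set Implicit Arguments.
Unset Strict Implicit.
Unset Printing Implicit Defensive.

Local Open Scope classical_set_scope.
Local Open Scope ring_scope.

(** * Norms on R^d and their continuity for the matrix topology *)

Section norm.
Context (R : realType) (d : nat) (N : 'rV[R]_d -> R) (hN : is_norm N).

Lemma is_normN x : N (- x) = N x.
Proof. by rewrite -scaleN1r norm_homogeneous// normrN1 mul1r. Qed.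

Lemma is_norm_dist x y : `|N x - N y| <= N (x - y).
Proof.
have h a b : N a - N b <= N (a - b).
  by rewrite lerBlDr; apply: le_trans (norm_subadditive hN _ _); rewrite subrK.
by rewrite ler_norml h lerNl opprB -(is_normN (x - y)) opprB h.
Qed.

Lemma is_norm_sum (I : Type) (s : seq I) (F : I -> 'rV[R]_d) :
  N (\sum_(i <- s) F i) <= \sum_(i <- s) N (F i).
Proof.
elim: s => [|i s IH].
  by rewrite !big_nil -(scale0r (0 : 'rV[R]_d)) norm_homogeneous// normr0 mul0r.
by rewrite !big_cons (le_trans (norm_subadditive hN _ _))// lerD2l.
Qed.

Lemma is_norm_coord_le x :
  N x <= \sum_c `|x 0 c| * N (delta_mx 0 c).
Proof.
rewrite {1}[x]row_sum_delta (le_trans (is_norm_sum _ _))// ler_sum// => c _.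
by rewrite norm_homogeneous.
Qed.

(** Expanding in the canonical basis bounds the change of [N] by a weighted sum of the coordinate
    changes, and coordinates are continuous. *)
Lemma continuous_norm_row k (l : 'I_k) :
  continuous (fun m : 'M[R]_(k, d) => N (row l m)).
Proof.
move=> m0; have FF : Filter (nbhs m0) by exact: nbhs_filter.
apply/(@cvgrPdist_le _ _ _ (nbhs m0)) => e e0.
have h : (fun m : 'M[R]_(k, d) => \sum_c `|m l c - m0 l c| * N (delta_mx 0 c))
    @ m0 --> 0.
  rewrite [X in _ --> X](_ : 0 = \sum_(c < d) `|m0 l c - m0 l c| * N (delta_mx 0 c)); last first.
    by rewrite big1// => c _; rewrite subrr normr0 mul0r.
  apply: (@cvg_big _ _ +%R) => [|c _]; first exact: add_continuous.
  apply: cvgMl; apply: cvg_norm; apply: cvgB; last exact: cvg_cst.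
  exact: coord_continuous.
have /cvgrPdist_le/(_ e e0) := h.
apply: filterS => m; rewrite sub0r normrN => hm.
apply: le_trans (is_norm_dist _ _) _.
apply: le_trans (is_norm_coord_le _) _.
apply: le_trans hm; apply: le_trans (ler_norm _).
by apply: ler_sum => c _; rewrite !mxE distrC.
Qed.

Lemma continuous_is_norm : continuous N.
Proof.
have := @continuous_norm_row 1 0.
rewrite (_ : (fun m : 'M[R]_(1, d) => N (row 0 m)) = N)//.
by apply/funext => x; congr N; apply/rowP => c; rewrite mxE.
Qed.

Lemma open_norm_gt v : open [set x | v < N x].
Proof.
rewrite -[X in open X]/(N @^-1` [set y | v < y]).
by apply: open_comp => [x _|]; [exact: continuous_is_norm | exact: open_gt].
Qed.

End norm.

(** * Path events generated by exceedances of levels *)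

Section level.
Context (R : realType) (d : nat) (N : 'rV[R]_d -> R).

Definition below (D : set int) (v : R) : set (int -> 'rV[R]_d) :=
  [set x | forall j, D j -> N (x j) <= v].

(* The index set [S] keeps track of a finite window, since stationarity is only
   assumed for finite stretches. *)
Definition level_sigma (S : set int) : set (set (int -> 'rV[R]_d)) :=
  <<s [set C | exists j v, S j /\ C = [set x | v < N (x j)]] >>.

Lemma level_sigma_gt S j v : S j -> level_sigma S [set x | v < N (x j)].
Proof. by move=> Sj; apply: sub_gen_smallest; exists j, v. Qed.

Lemma level_sigmaC S C : level_sigma S C -> level_sigma S (~` C).
Proof. exact: (@measurableC _ (g_sigma_algebraType _)). Qed.

Lemma level_sigmaI S C C' : level_sigma S C -> level_sigma S C' ->
  level_sigma S (C `&` C').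
Proof. exact: (@measurableI _ (g_sigma_algebraType _)). Qed.

Lemma level_sigma_below S D v : D `<=` S -> level_sigma S (below D v).
Proof.
move=> DS.
rewrite [X in level_sigma _ X](_ : _ =
  ~` (\bigcup_(j : int) [set x | D j /\ v < N (x j)])); last first.
  apply/seteqP; split => x /=.
    by move=> h [j _ [Dj]]; rewrite ltNge h.
  move=> h j Dj; rewrite leNgt; apply/negP => vx; apply: h.
  by exists j.
apply: level_sigmaC.
apply: (@countable_bigcupT_measurable _ (g_sigma_algebraType
  [set C | exists j v, S j /\ C = [set x | v < N (x j)]])) => // j.
have [Dj|Dj] := pselect (D j).
  rewrite (_ : [set x | D j /\ _] = [set x | v < N (x j)]).
    exact: level_sigma_gt (DS _ Dj).
  by apply/seteqP; split => x /=; [case|split].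
rewrite (_ : [set x | D j /\ _] = set0).
  exact: sigma_algebra0.
by apply/seteqP; split => x //= [].
Qed.

Context (hN : is_norm N).

Lemma measurable_process (dT : measure_display) (T : measurableType dT)
    (X : int -> T -> 'rV[R]_d) C :
  is_process X -> level_sigma setT C -> measurable [set t | C (X ^~ t)].
Proof.
move=> hX.
suff /[apply] : level_sigma setT `<=` image_set_system setT (fun t j => X j t)
    (@measurable _ T) by rewrite /image_set_system/= setTI.
apply: smallest_sub => [|_ [j [v [_ ->]]]].
  exact: sigma_algebra_image (@sigma_algebra_measurable _ T).
rewrite /image_set_system/= setTI.
have := hX j measurableT [set x | v < N x].
rewrite setTI; apply.
by apply: sub_gen_smallest; exact: open_norm_gt.
Qed.

Lemma path_measurable_level C : level_sigma setT C -> path_measurable C.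
Proof.
apply: sub_smallest2r; first exact: smallest_sigma_algebra.
move=> {}C [j [v [_ ->]]].
exists j, [set x | v < N x]; split => //.
by apply: sub_gen_smallest; exact: open_norm_gt.
Qed.

(** The preimages of Borel sets under the map from a path to its block over [-K, K] form a
    sigma-algebra containing the generators. Hence [C] is such a preimage, and stationarity of
    finite stretches applies to it. *)
Lemma stationary_level (dT : measure_display) (T : measurableType dT)
    (P : probability T R) (X : int -> T -> 'rV[R]_d) (K : nat) (h : int) C :
  stationary P X -> level_sigma [set j | `|j| <= K%:Z] C ->
  P [set t | C (fun j => X (j + h) t)] = P [set t | C (X ^~ t)].
Proof.
move=> hst hC.
have [B Bm <-] : preimage_set_system setT
    (fun x => block x (- K%:Z) (K + K)) <<s @open 'M[R]_((K + K).+1, d) >> C.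
  move: C hC; apply: smallest_sub => [|_ [j [v [/= jK ->]]]].
    by apply: sigma_algebra_preimage; exact: smallest_sigma_algebra.
  (* Row j + K of the block holds x_j. *)
  have lK : (absz (j + K%:Z)%R < (K + K).+1)%N by lia.
  exists [set m | v < N (row (Ordinal lK) m)].
    apply: sub_gen_smallest.
    rewrite -[X in open X]/((fun m => N (row (Ordinal lK) m)) @^-1` [set y | v < y]).
    by apply: open_comp => [x _|]; [exact: continuous_norm_row | exact: open_gt].
  rewrite setTI; apply/seteqP; split => x /=; congr (v < N _);
    apply/rowP => c; rewrite !mxE /=; congr (x _ _ _); lia.
rewrite setTI -[RHS](hst h _ _ _ Bm); congr (P _).
apply/seteqP; split => t /=; congr B; apply/matrixP => a b;
  rewrite !mxE; congr (X _ _ _ _); lia.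
Qed.

End level.

(** * Real-valued probabilities and bounds for integrals *)

Section prob.
Context (R : realType) (dT : measure_display) (T : measurableType dT)
  (P : probability T R).
Implicit Types A B : set T.

Lemma prob_EFin A : measurable A -> (prob P A)%:E = P A.
Proof. by move=> mA; rewrite /prob fineK// fin_num_measure. Qed.

Lemma prob_ge0 A : 0 <= prob P A.
Proof.
have : (0 <= P A)%E by exact: measure_ge0.
by rewrite /prob; case: (P A).
Qed.

Lemma prob_mono A B : measurable A -> measurable B -> A `<=` B ->
  prob P A <= prob P B.
Proof.
by move=> mA mB AB; rewrite -lee_fin !prob_EFin// le_measure ?inE.
Qed.

Lemma prob_split A B : measurable A -> measurable B ->
  prob P A = prob P (A `&` B) + prob P (A `&` ~` B).
Proof.
move=> mA mB; apply: EFin_inj; rewrite EFinD !prob_EFin//; last 2 first.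
- by apply: measurableI => //; exact: measurableC.
- exact: measurableI.
by rewrite -setDE addeC; exact: measureDI.
Qed.

Lemma prob_le_sum (I : Type) (s : seq I) (F : I -> set T) A :
  measurable A -> (forall i, measurable (F i)) ->
  A `<=` \big[setU/set0]_(i <- s) F i ->
  prob P A <= \sum_(i <- s) prob P (F i).
Proof.
move=> + mF; elim: s A => [|i s IH] A mA.
  by rewrite !big_nil subset0 => ->; rewrite /prob measure0.
rewrite !big_cons (prob_split mA (mF i)) => Asub.
have mC : measurable (A `&` ~` F i) by apply: measurableI => //; exact: measurableC.
apply: lerD; first by apply: prob_mono => //; exact: measurableI.
by apply: IH => // t [/Asub[]].
Qed.

Lemma cvg_prob_bigcap (F : nat -> set T) : (forall n, measurable (F n)) ->
  {homo F : n m / (n <= m)%N >-> m `<=` n} ->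
  prob P (F n) @[n --> \oo] --> prob P (\bigcap_n F n).
Proof.
move=> mF dF; have mI : measurable (\bigcap_n F n) by exact: bigcapT_measurable.
suff : P (F n) @[n --> \oo] --> (prob P (\bigcap_n F n))%:E by exact: fine_cvg.
rewrite prob_EFin//; apply: nonincreasing_cvg_mu => //.
  exact: le_lt_trans (probability_le1 P (mF 0)) (ltry 1).
by move=> n m nm; apply/subsetPset; exact: dF.
Qed.

Lemma bounded_integrable A (f : T -> R) : measurable A ->
  measurable_fun setT f -> (exists M, forall t, `|f t| <= M) ->
  P.-integrable A (EFin \o f).
Proof.
move=> mA mf [M fM]; apply: measurable_bounded_integrable => //.
- exact: le_lt_trans (probability_le1 P mA) (ltry 1).
- exact: measurable_funTS.
- by exists M; split; [exact: num_real|move=> y My t _; apply: le_trans (fM t) (ltW My)].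
Qed.

Lemma Rintegral_indic A B : measurable A -> measurable B ->
  \int[P]_(t in A) \1_B t = prob P (A `&` B).
Proof.
by move=> mA mB; rewrite /Rintegral integral_indic// setIC.
Qed.

Lemma indic_bounded B : exists M, forall t : T, `|\1_B t| <= M :> R.
Proof. by exists 1 => t; rewrite indicE; case: (_ \in _); rewrite ?normr1 ?normr0. Qed.

(** Weak convergence tests continuous functions only; here [f] stands for a continuous substitute of
    the indicator of [B] and [g] for a continuous bound on the error. *)
Lemma prob_approx A B (f g : T -> R) : measurable A -> measurable B ->
  measurable_fun setT f -> measurable_fun setT g ->
  (exists M, forall t, `|f t| <= M) -> (exists M, forall t, `|g t| <= M) ->
  (forall t, `|\1_B t - f t| <= g t) ->
  `|prob P (A `&` B) - \int[P]_(t in A) f t| <= \int[P]_(t in A) g t.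
Proof.
move=> mA mB mf mg bf bg fg.
have iB : P.-integrable A (EFin \o (\1_B : T -> R)).
  apply: bounded_integrable => //; exact: indic_bounded.
have i_f := bounded_integrable mA mf bf; have ig := bounded_integrable mA mg bg.
have iBf : P.-integrable A (EFin \o (fun t => \1_B t - f t)).
  by have := integrableB mA iB i_f; apply: eq_integrable.
rewrite -Rintegral_indic// -RintegralB//.
apply: le_trans (le_normr_Rintegral mA iBf) _.
apply: le_Rintegral => //.
exact: integrable_norm.
Qed.

Lemma Rintegral_le_prob_sum (I : Type) (s : seq I) (F : I -> set T) A
    (g : T -> R) : measurable A -> (forall i, measurable (F i)) ->
  measurable_fun setT g -> (exists M, forall t, `|g t| <= M) ->
  (forall t, g t <= \sum_(i <- s) \1_(F i) t) ->
  \int[P]_(t in A) g t <= \sum_(i <- s) prob P (F i).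
Proof.
move=> mA mF mg bg gF.
have iF i : P.-integrable A (EFin \o (\1_(F i) : T -> R)).
  apply: bounded_integrable => //; exact: indic_bounded.
(* Integrability and the value of the integral go through the induction together, since additivity
   of the integral requires the former. *)
have [iS eS] : P.-integrable A (EFin \o (fun t => \sum_(i <- s) \1_(F i) t : R))
    /\ \int[P]_(t in A) (\sum_(i <- s) \1_(F i) t) = \sum_(i <- s) prob P (A `&` F i).
  elim: s {gF} => [|i s [IH1 IH2]].
    rewrite big_nil; split.
      apply: eq_integrable (integrable0 P A) => // t _ /=.
      by rewrite big_nil.
    under eq_Rintegral do rewrite big_nil.
    by rewrite Rintegral_cst// mul0r.
  split.
    apply: eq_integrable (integrableD mA (iF i) IH1) => // t _ /=.
    by rewrite big_cons EFinD.
  under eq_Rintegral do rewrite big_cons.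
  by rewrite RintegralD// IH2 big_cons Rintegral_indic.
apply: le_trans (le_Rintegral mA (bounded_integrable mA mg bg) iS (fun t _ => gF t)) _.
rewrite eS; apply: ler_sum => i _; apply: prob_mono => //; exact: measurableI.
Qed.
End prob.

(** * Continuous substitutes for the indicator of v <= 1 *)

Section ramp.
Context (R : realType).
Implicit Types e v : R.

(** Falls linearly from 1 at 1 - e to 0 at 1 + e. *)
Definition ramp e v : R := Num.min 1 (Num.max 0 ((1 + e - v) / (e + e))).

(** A trapezoid centred at 1, with plateau up to distance e and support up to distance 2e. Its
    continuity lets the error of [ramp] pass to the limit as well. *)
Definition bump e v : R := Num.max 0 (Num.min 1 (2 - `|v - 1| / e)).

Lemma ramp_ge0 e v : 0 <= ramp e v.
Proof. by rewrite le_min ler01 le_max lexx. Qed.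

Lemma ramp_le1 e v : ramp e v <= 1.
Proof. by rewrite ge_min lexx. Qed.

Lemma bump_ge0 e v : 0 <= bump e v.
Proof. by rewrite le_max lexx. Qed.

Lemma bump_le1 e v : bump e v <= 1.
Proof. by rewrite ge_max ler01 ge_min lexx. Qed.

Lemma ramp1 e v : 0 < e -> v <= 1 - e -> ramp e v = 1.
Proof.
move=> e0 ve; apply/min_idPl; rewrite le_max; apply/orP; right.
by rewrite ler_pdivlMr; lra.
Qed.

Lemma ramp0 e v : 0 < e -> 1 + e <= v -> ramp e v = 0.
Proof.
move=> e0 ve; rewrite /ramp (max_idPl _) ?(min_idPr _)//.
by rewrite ler_pdivrMr; lra.
Qed.

Lemma bump1 e v : 0 < e -> `|v - 1| <= e -> bump e v = 1.
Proof.
move=> e0 ve; rewrite /bump (min_idPl _) ?(max_idPr _)//.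
have : `|v - 1| / e <= 1 by rewrite ler_pdivrMr ?mul1r.
by lra.
Qed.

Lemma bump0 e v : 0 < e -> 2 * e <= `|v - 1| -> bump e v = 0.
Proof.
move=> e0 ve; apply/max_idPl; rewrite ge_min; apply/orP; right.
have : 2 <= `|v - 1| / e by rewrite ler_pdivlMr.
by lra.
Qed.

Lemma continuous_ramp e : continuous (ramp e).
Proof.
move=> v; apply: (@continuous_min _ _ (cst 1)
  (fun v => Num.max 0 ((1 + e - v) / (e + e)))); first exact: cvg_cst.
apply: (@continuous_max _ _ (cst 0) (fun v => (1 + e - v) / (e + e))).
  exact: cvg_cst.
by apply: cvgMl; apply: cvgB; [exact: cvg_cst|exact: cvg_id].
Qed.

Lemma continuous_bump e : continuous (bump e).
Proof.
move=> v; apply: (@continuous_max _ _ (cst 0)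
  (fun v => Num.min 1 (2 - `|v - 1| / e))); first exact: cvg_cst.
apply: (@continuous_min _ _ (cst 1) (fun v => 2 - `|v - 1| / e)).
  exact: cvg_cst.
apply: cvgB; first exact: cvg_cst.
apply: cvgMl; apply: cvg_norm; apply: cvgB; [exact: cvg_id|exact: cvg_cst].
Qed.

(* Continuous version of the indicator of [v l <= 1 for all l in A]; it is exact
   unless some [v l] is within [e] of the discontinuity, where [soft_edge] is at
   least 1. *)
Definition soft_below e k (A : pred 'I_k) (v : 'I_k -> R) : R :=
  \prod_(l < k | A l) ramp e (v l).

Definition soft_edge e k (v : 'I_k -> R) : R := \sum_(l < k) bump e (v l).

Lemma soft_below_itv e k (A : pred 'I_k) (v : 'I_k -> R) : 0 <= soft_below e A v <= 1.
Proof.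
rewrite prodr_ge0 => [|l _]; last exact: ramp_ge0.
by apply: prodr_ile1 => l _; rewrite ramp_ge0 ramp_le1.
Qed.

Lemma soft_edge_itv e k (v : 'I_k -> R) : 0 <= soft_edge e v <= k%:R.
Proof.
apply/andP; split; first by apply: sumr_ge0 => l _; exact: bump_ge0.
have : soft_edge e v <= \sum_(l < k) 1 by apply: ler_sum => l _; exact: bump_le1.
by rewrite sumr_const card_ord.
Qed.

Lemma soft_below_approx e k (A : pred 'I_k) (v : 'I_k -> R) (b : bool) : 0 < e ->
  (b <-> (forall l, A l -> v l <= 1)) ->
  `|b%:R - soft_below e A v| <= soft_edge e v.
Proof.
move=> e0 bP; have /andP[s0 s1] := soft_below_itv e A v.
have [[l le]|far] := pselect (exists l, `|v l - 1| <= e).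
  apply: (@le_trans _ _ 1).
    by case: b {bP} => /=; rewrite ler_norml; lra.
  rewrite /soft_edge (bigD1 l)//= bump1// lerDl.
  by apply: sumr_ge0 => i _; exact: bump_ge0.
suff -> : soft_below e A v = b%:R.
  by rewrite subrr normr0; have /andP[] := soft_edge_itv e v.
case: (boolP b) => [/bP all1|/negP nb].
  apply: big1 => l /all1 vl; apply: ramp1 => //.
  rewrite leNgt; apply/negP => evl; apply: far; exists l.
  by rewrite ler_norml; lra.
have [l Al vl] : exists2 l, A l & 1 < v l.
  apply: contrapT => h; apply: nb; apply/bP => l Al.
  by rewrite leNgt; apply/negP => vl; apply: h; exists l.
rewrite /soft_below (bigD1 l)//= ramp0 ?mul0r//.
rewrite leNgt; apply/negP => evl; apply: far; exists l.
by rewrite ler_norml; lra.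
Qed.
End ramp.

(** * Measurability along a process and approximation of window events *)

Section process.
Context (R : realType) (d : nat) (N : 'rV[R]_d -> R) (hN : is_norm N)
  (dT : measure_display) (T : measurableType dT) (X : int -> T -> 'rV[R]_d)
  (hX : is_process X).

Lemma measurable_exceeds j v : measurable (exceeds N X j v).
Proof. exact: (measurable_process hN hX (@level_sigma_gt _ _ N setT j v I)). Qed.

Lemma measurable_below D v : measurable [set t | below N D v (X ^~ t)].
Proof. exact: (measurable_process hN hX (@level_sigma_below _ _ N setT D v (@subsetT _ D))). Qed.

Lemma measurable_norm_process j : measurable_fun setT (fun t => N (X j t)).
Proof.
apply: (measurability _ (RGenOInfty.measurableE R)) => // _ [_ [v ->] <-].
rewrite setTI (_ : _ @^-1` _ = exceeds N X j v); first exact: measurable_exceeds.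
by apply/seteqP; split => t /=; rewrite in_itv/= andbT.
Qed.

Lemma norm_row_block c i k (l : 'I_k.+1) t : 0 < c ->
  N (row l (c *: block (X ^~ t) i k)) = c * N (X (i + (l : nat)%:Z) t).
Proof.
move=> c0; rewrite -{2}(gtr0_norm c0) -norm_homogeneous//; congr N.
by apply/rowP => b; rewrite !mxE.
Qed.

Lemma measurable_norm_block c i k (l : 'I_k.+1) : 0 < c ->
  measurable_fun setT (fun t => N (row l (c *: block (X ^~ t) i k))).
Proof.
move=> c0; under eq_fun do rewrite norm_row_block//.
by apply: measurableT_comp (measurable_norm_process _); exact: mulrl_measurable.
Qed.

Lemma measurable_soft_below e c i k (A : pred 'I_k.+1) : 0 < c ->
  measurable_fun setT
    (fun t => soft_below e A (fun l => N (row l (c *: block (X ^~ t) i k)))).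
Proof.
move=> c0.
have -> : (fun t => soft_below e A (fun l => N (row l (c *: block (X ^~ t) i k)))) =
  (fun t => \prod_(l <- [seq l <- enum 'I_k.+1 | A l])
     ramp e (N (row l (c *: block (X ^~ t) i k)))).
  by apply/funext => t; rewrite big_filter big_enum_cond.
apply: measurable_prod => l _.
apply: measurableT_comp (measurable_norm_block _ _ c0).
by apply: continuous_measurable_fun; exact: continuous_ramp.
Qed.

Lemma measurable_soft_edge e c i k : 0 < c ->
  measurable_fun setT
    (fun t => soft_edge e (fun l : 'I_k.+1 => N (row l (c *: block (X ^~ t) i k)))).
Proof.
move=> c0; apply: measurable_sum => l.
apply: measurableT_comp (measurable_norm_block _ _ c0).
by apply: continuous_measurable_fun; exact: continuous_bump.
Qed.

Lemma below_block_approx (D : set int) e c i k t : 0 < e -> 0 < c ->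
  (forall j, D j -> i <= j <= i + k%:Z) ->
  `|\1_[set t | below N D c^-1 (X ^~ t)] t
    - soft_below e (fun l : 'I_k.+1 => `[< D (i + (l : nat)%:Z) >])
        (fun l => N (row l (c *: block (X ^~ t) i k)))|
  <= soft_edge e (fun l : 'I_k.+1 => N (row l (c *: block (X ^~ t) i k))).
Proof.
move=> e0 c0 Dik; rewrite indicE; apply: soft_below_approx => //.
rewrite inE/=; split => [h l /asboolP Dl|h j Dj].
  by rewrite norm_row_block// mulrC -ler_pdivlMr// mul1r; exact: h.
have /andP[ij jk] := Dik _ Dj.
have lk : (absz (j - i)%R < k.+1)%N by lia.
have el : i + (absz (j - i)%R)%:Z = j by lia.
have := h (Ordinal lk); rewrite norm_row_block//= el => /(_ (asboolT Dj)).
by rewrite mulrC -ler_pdivlMr// mul1r.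
Qed.
End process.

(** * Continuity of the approximations as functions of a block *)

Section matrix.
Context (R : realType) (d : nat) (N : 'rV[R]_d -> R) (hN : is_norm N).

Lemma continuous_soft_below e k (A : pred 'I_k.+1) :
  continuous (fun m : 'M[R]_(k.+1, d) => soft_below e A (fun l => N (row l m))).
Proof.
apply: (@continuous_big R _ *%R 1 A _ 'M[R]_(k.+1, d) _
  (fun l m => ramp e (N (row l m)))) => [|l _]; first exact: mul_continuous.
move=> m; apply: (@continuous_comp _ _ _ (fun m : 'M[R]_(k.+1, d) => N (row l m))).
  exact: continuous_norm_row.
exact: continuous_ramp.
Qed.

Lemma continuous_soft_edge e k :
  continuous (fun m : 'M[R]_(k.+1, d) =>
    soft_edge e (fun l : 'I_k.+1 => N (row l m))).
Proof.
apply: (@continuous_big R _ +%R 0 xpredT _ 'M[R]_(k.+1, d) _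
  (fun l m => bump e (N (row l m)))) => [|l _]; first exact: add_continuous.
move=> m; apply: (@continuous_comp _ _ _ (fun m : 'M[R]_(k.+1, d) => N (row l m))).
  exact: continuous_norm_row.
exact: continuous_bump.
Qed.
End matrix.

(** With a = -alpha, the difference is the limiting relative mass of |X_0| in the band between (1 -
    2e)x and (1 + 2e)x; continuity of the power at 1 makes it small. The bound e < 1/2 keeps 1 - 2e
    positive, where regular variation applies. *)
Lemma powR_gap (R : realType) (a M eta : R) : 0 < eta ->
  exists2 e : R, 0 < e < 2^-1 &
    M * ((1 - 2 * e) `^ a - (1 + 2 * e) `^ a) < eta.
Proof.
move=> eta0.
have c1 : {for (1 : R), continuous (fun y : R => y `^ a)}.
  apply: differentiable_continuous; apply/derivable1_diffP.
  by apply: derivable_powR; rewrite in_itv/= ltr01.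
have M0 : 0 < `|M| + 1 by rewrite ltr_wpDl.
have /cvgrPdist_lt/(_ (eta / (2 * (`|M| + 1)))) :=
  (c1 : (fun y : R => y `^ a) @ (1 : R) --> (1 : R) `^ a).
rewrite divr_gt0 ?mulr_gt0// => /(_ isT) [rho /= rho0 h].
(* The first term gives e < 1/2, the second places 1 - 2e and 1 + 2e within [rho] of 1. *)
pose e := Num.min (4^-1) (rho / 4).
have e0 : 0 < e by rewrite lt_min invr_gt0 ltr0n divr_gt0.
have e4 : e <= 4^-1 by rewrite ge_min lexx.
have er : e <= rho / 4 by rewrite ge_min lexx orbT.
exists e; first by rewrite e0/=; lra.
have h1 : `|1 `^ a - (1 - 2 * e) `^ a| < eta / (2 * (`|M| + 1)).
  by apply: h => /=; rewrite ltr_norml; lra.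
have h2 : `|1 `^ a - (1 + 2 * e) `^ a| < eta / (2 * (`|M| + 1)).
  by apply: h => /=; rewrite ltr_norml; lra.
have h3 : `|(1 - 2 * e) `^ a - (1 + 2 * e) `^ a| < eta / (`|M| + 1).
  have -> : eta / (`|M| + 1) = eta / (2 * (`|M| + 1)) + eta / (2 * (`|M| + 1)).
    by field; lra.
  by move: h1 h2; rewrite !ltr_norml; lra.
apply: le_lt_trans (ler_norm _) _; rewrite normrM.
rewrite ltr_pdivlMr// in h3.
apply: le_lt_trans h3; rewrite mulrC ler_wpM2l//; lra.
Qed.

(** * Convergence of window probabilities to those of the tail process *)

Section limit.
Context (R : realType) (d : nat) (N : 'rV[R]_d -> R) (hN : is_norm N)
  (dX : measure_display) (TX : measurableType dX) (P : probability TX R)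
  (X : int -> TX -> 'rV[R]_d) (hX : is_process X) (hstat : stationary P X).

Lemma prob_exceeds_shift j v :
  prob P (exceeds N X j v) = prob P (exceeds N X 0 v).
Proof.
have S0 : level_sigma N [set j | `|j| <= 0%:Z] [set x | v < N (x 0)].
  by apply: level_sigma_gt; rewrite /= normr0.
have := stationary_level hN j hstat S0.
by rewrite /= add0r /prob /exceeds => ->.
Qed.

Context (alpha : R) (hRV : tail_index N P X alpha)
  (dY : measure_display) (TY : measurableType dY) (PY : probability TY R)
  (Y : int -> TY -> 'rV[R]_d) (hY : tail_process N P X PY Y).

(** The indicator of the window event differs from the continuous [f] by at most the continuous [g].
    The integral of [g] under Y is a limit of integrals under X, and these are bounded by the chance
    that some norm in the window lies near x. Dropping the condition |X_0| > x there, stationarity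
    moves each such band to time 0, where regular variation makes it small. So an atom of |Y_j| at 1
    is excluded along the way. *)
Lemma cvg_below_window (D : set int) (i : int) (k : nat) :
  (forall j, D j -> i <= j <= i + k%:Z) ->
  prob P (exceeds N X 0 x `&` [set t | below N D x (X ^~ t)])
    / prob P (exceeds N X 0 x) @[x --> +oo] -->
  prob PY [set t | below N D 1 (Y ^~ t)].
Proof.
move=> Dik; have [tail0 tailRV] := hRV; have [pY cvgY] := hY.
apply/cvgrPdist_le => eta eta0.
have [|e /andP[e0 e2] gap] := @powR_gap R (- alpha) k.+1%:R (eta / 4).
  by rewrite divr_gt0.
pose A := fun l : 'I_k.+1 => `[< D (i + (l : nat)%:Z) >].
pose f (m : 'M[R]_(k.+1, d)) := soft_below e A (fun l => N (row l m)).
pose g (m : 'M[R]_(k.+1, d)) := soft_edge e (fun l => N (row l m)).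
have bf m : `|f m| <= 1.
  by have /andP[f0 f1] := soft_below_itv e A (fun l => N (row l m)); rewrite ger0_norm.
have bg m : `|g m| <= k.+1%:R.
  by have /andP[g0 g1] := soft_edge_itv e (fun l => N (row l m)); rewrite ger0_norm.
have cf : continuous f by exact: continuous_soft_below.
have cg : continuous g by exact: continuous_soft_edge.
have lim_f := cvgY i k f cf (ex_intro _ _ bf).
have lim_g := cvgY i k g cg (ex_intro _ _ bg).
set F := \int[PY]_(t in _) _ in lim_f.
set G := \int[PY]_(t in _) _ in lim_g.
have Yfg : `|prob PY [set t | below N D 1 (Y ^~ t)] - F| <= G.
  rewrite -[X in prob PY X]setTI; apply: prob_approx.
  - by [].
  - exact: measurable_below.
  - have := measurable_soft_below hN pY e i A ltr01.
    by under eq_fun do rewrite scale1r.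
  - have := measurable_soft_edge hN pY e i k ltr01.
    by under eq_fun do rewrite scale1r.
  - by exists 1.
  - by exists k.+1%:R.
  move=> t; have := below_block_approx hN Y t e0 ltr01 Dik.
  by rewrite invr1 scale1r.
have Xfg x : 0 < x -> `|prob P (exceeds N X 0 x `&` [set t | below N D x (X ^~ t)])
    - \int[P]_(t in exceeds N X 0 x) f (x^-1 *: block (X ^~ t) i k)|
    <= \int[P]_(t in exceeds N X 0 x) g (x^-1 *: block (X ^~ t) i k).
  move=> x0; have xV0 : 0 < x^-1 by rewrite invr_gt0.
  apply: prob_approx.
  - exact: measurable_exceeds.
  - exact: measurable_below.
  - exact: measurable_soft_below.
  - exact: measurable_soft_edge.
  - by exists 1.
  - by exists k.+1%:R.
  by move=> t; have := below_block_approx hN X t e0 xV0 Dik; rewrite invrK.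
(* Between these two levels lie all norms at which the bump does not vanish. *)
pose lo x (l : 'I_k.+1) := exceeds N X (i + (l : nat)%:Z) (x * (1 - 2 * e)).
pose hi x (l : 'I_k.+1) := exceeds N X (i + (l : nat)%:Z) (x * (1 + 2 * e)).
have mlo x l : measurable (lo x l) by exact: measurable_exceeds.
have mhi x l : measurable (hi x l) by exact: measurable_exceeds.
have Xg x : 0 < x ->
    \int[P]_(t in exceeds N X 0 x) g (x^-1 *: block (X ^~ t) i k)
    <= \sum_(l < k.+1) prob P (lo x l `&` ~` hi x l).
  move=> x0; have xV0 : 0 < x^-1 by rewrite invr_gt0.
  apply: Rintegral_le_prob_sum.
  - exact: measurable_exceeds.
  - by move=> l; apply: measurableI => //; exact: measurableC.
  - exact: measurable_soft_edge.
  - by exists k.+1%:R.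
  move=> t; apply: ler_sum => l _; rewrite norm_row_block// indicE.
  set n := N _.
  have [far|near1] := leP (2 * e) `|x^-1 * n - 1|; first by rewrite bump0.
  rewrite mem_set ?bump_le1//.
  move: near1; rewrite ltr_norml => /andP[n1 n2]; split.
    by rewrite /lo /exceeds/= -/n -ltr_pdivlMl//; lra.
  rewrite /hi /exceeds/= -/n; apply/negP; rewrite -leNgt -ler_pdivrMl//; lra.
have edge x l : 0 < x -> prob P (lo x l `&` ~` hi x l) =
    prob P (exceeds N X 0 (x * (1 - 2 * e)))
    - prob P (exceeds N X 0 (x * (1 + 2 * e))).
  move=> x0; rewrite -(prob_exceeds_shift (i + (l : nat)%:Z)).
  rewrite -[X in _ - X](prob_exceeds_shift (i + (l : nat)%:Z)).
  rewrite [X in X - _](prob_split P (mlo x l) (mhi x l)) (@setIidr _ (lo x l) (hi x l)).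
    by rewrite /hi; ring.
  move=> t; rewrite /hi /lo /exceeds/=; apply: le_lt_trans.
  by rewrite ler_pM2l//; lra.
have Gle : G <= eta / 4.
  apply: le_trans (ltW gap).
  have lim_edge : k.+1%:R *
      (prob P (exceeds N X 0 (x * (1 - 2 * e))) / prob P (exceeds N X 0 x)
      - prob P (exceeds N X 0 (x * (1 + 2 * e))) / prob P (exceeds N X 0 x))
      @[x --> +oo] -->
      k.+1%:R * ((1 - 2 * e) `^ (- alpha) - (1 + 2 * e) `^ (- alpha)).
    by apply: cvgMr; apply: cvgB; apply: tailRV; lra.
  apply: (ler_cvg_to lim_g lim_edge).
  near=> x; have x0 : 0 < x by near: x; exact: nbhs_pinfty_gt.
  rewrite -mulrBl mulrA ler_wpM2r// ?invr_ge0 ?prob_ge0//.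
  apply: le_trans (Xg _ x0) _.
  under eq_bigr do rewrite edge//.
  by rewrite sumr_const card_ord [leRHS]mulr_natl.
(* The error [eta] is spent in quarters: [G] for Y, the convergence of the integrals of [f], and,
   for X, [G] again plus the convergence of the integrals of [g]. *)
move/cvgrPdist_le/(_ (eta / 4)) : lim_f; rewrite divr_gt0// => /(_ isT) lim_f.
move/cvgrPdist_le/(_ (eta / 4)) : lim_g; rewrite divr_gt0// => /(_ isT) lim_g.
near=> x; have x0 : 0 < x by near: x; exact: nbhs_pinfty_gt.
have p0 := tail0 x.
have hf : `|F - (\int[P]_(t in exceeds N X 0 x) f (x^-1 *: block (X ^~ t) i k))
  / prob P (exceeds N X 0 x)| <= eta / 4 by near: x.
have hg : `|G - (\int[P]_(t in exceeds N X 0 x) g (x^-1 *: block (X ^~ t) i k))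
  / prob P (exceeds N X 0 x)| <= eta / 4 by near: x.
have h := Xfg x x0.
have pV0 : 0 < (prob P (exceeds N X 0 x))^-1 by rewrite invr_gt0.
rewrite -(ler_pM2r pV0) -{1}(gtr0_norm pV0) -normrM mulrBl in h.
move: h hf hg Yfg; rewrite !ler_norml; lra.
Unshelve. all: by end_near. Qed.
End limit.

(** * Interchange of limits *)

Section sequences.
Context (R : realType).

(** A three-epsilon argument at a single K; the rank in n from which the approximation is good may
    depend on K. *)
Lemma cvg_approx (a : nat -> R) (b : nat -> nat -> R) (c : nat -> R) (l : R) :
  (forall e, 0 < e -> \forall K \near \oo, \forall n \near \oo,
    `|a n - b n K| <= e) ->
  (forall K, b n K @[n --> \oo] --> c K) -> c K @[K --> \oo] --> l ->
  a n @[n --> \oo] --> l.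
Proof.
move=> ab bc cl; apply/cvgrPdist_le => e e0.
have e3 : 0 < e / 3 by rewrite divr_gt0.
have /cvgrPdist_le/(_ _ e3) clK := cl.
have [K [abK cK]] := filter_ex (filterI (ab _ e3) clK).
have /cvgrPdist_le/(_ _ e3) bK := bc K.
near=> n.
have h1 : `|a n - b n K| <= e / 3 by near: n.
have h2 : `|c K - b n K| <= e / 3 by near: n.
by move: h1 h2 cK; rewrite !ler_norml; lra.
Unshelve. all: by end_near. Qed.

(** Tannery's theorem with uniformly small tails in place of a dominating series. A cutoff [K0] with
    tails at most 1 bounds the partial sums of [b] by [B K0 + 1], so they converge; [r n] tending to
    infinity lets every fixed K fit in the range of summation. *)
Lemma tannery (a : nat -> nat -> R) (b : nat -> R) (r : nat -> nat) :
  r n @[n --> \oo] --> \oo ->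
  (forall n k, 0 <= a n k) -> (forall k, a n k @[n --> \oo] --> b k) ->
  (forall e, 0 < e -> \forall K \near \oo, \forall n \near \oo,
    \sum_(K <= k < (r n).+1) a n k <= e) ->
  exists2 s : R, \sum_(1 <= k < (r n).+1) a n k @[n --> \oo] --> s &
    \sum_(1 <= k < K) b k @[K --> \oo] --> s.
Proof.
move=> r_oo a0 ab atail.
have lim_sum m K : \sum_(m <= k < K) a n k @[n --> \oo] --> \sum_(m <= k < K) b k.
  by apply: (@cvg_big _ _ +%R) => [|k _]; [exact: add_continuous|exact: ab].
have b0 k : 0 <= b k.
  by apply: (ler_cvg_to (cvg_cst (0 : R)) (ab k)); exact: nearW.
pose B K := \sum_(1 <= k < K) b k.
have Bnd : nondecreasing_seq B.
  apply/nondecreasing_seqP => -[|n]; rewrite /B; first by rewrite !big_geq.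
  by rewrite [leRHS]big_nat_recr//= lerDl.
have [K0 [K01 tail1]] : exists K0, (1 <= K0)%N /\ \forall n \near \oo,
    \sum_(K0 <= k < (r n).+1) a n k <= 1.
  have [K0 [? ?]] := filter_ex (filterI (nbhs_infty_ge 1) (atail 1 ltr01)).
  by exists K0.
have Bub K : B K <= B K0 + 1.
  have [KK0|/ltnW K0K] := leqP K K0.
    by apply: le_trans (Bnd _ _ KK0) _; rewrite lerDl.
  rewrite /B (big_cat_nat K01 K0K)/= lerD2l.
  apply: (ler_cvg_to (lim_sum K0 K) (cvg_cst (1 : R))).
  near=> n.
  have rK : (K <= (r n).+1)%N by apply: leqW; near: n; exact: r_oo (nbhs_infty_ge K).
  have : \sum_(K0 <= k < (r n).+1) a n k <= 1 by near: n.
  rewrite (big_cat_nat K0K rK)/=; apply: le_trans.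
  by rewrite lerDl; apply: sumr_ge0.
have /cvg_ex[s Bs] : cvgn B.
  apply: nondecreasing_is_cvgn => //; exists (B K0 + 1) => _ [K _ <-]; exact: Bub.
exists s => //.
apply: (@cvg_approx _ (fun n K => \sum_(1 <= k < K) a n k) B) => // e e0.
near=> K.
have K1 : (1 <= K)%N by near: K; exact: nbhs_infty_ge.
have atK : \forall n \near \oo, \sum_(K <= k < (r n).+1) a n k <= e.
  by near: K; exact: atail.
near=> n.
have rK : (K <= (r n).+1)%N by apply: leqW; near: n; exact: r_oo (nbhs_infty_ge K).
rewrite (big_cat_nat K1 rK)/= addrAC subrr add0r.
rewrite ger0_norm; last by apply: sumr_ge0.
by near: n.
Unshelve. all: by end_near. Qed.

End sequences.

(** * Joint exceedances and the consequence of condition S^(1) *)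

Section cluster.
Context (R : realType) (d : nat) (N : 'rV[R]_d -> R) (hN : is_norm N)
  (dX : measure_display) (TX : measurableType dX) (P : probability TX R)
  (X : int -> TX -> 'rV[R]_d) (hX : is_process X) (hstat : stationary P X).

Definition joint (v : R) (j : nat) : R :=
  prob P (exceeds N X 0 v `&` exceeds N X j%:Z v).

Definition isolated (D : set int) (v : R) : R :=
  prob P (exceeds N X 0 v `&` [set t | below N D v (X ^~ t)]).

Lemma joint_ge0 v j : 0 <= joint v j.
Proof. exact: prob_ge0. Qed.

(** The condition is taken at s = t = 1 with c = 2, since times in two adjacent blocks may be more
    than r_n apart. A limsup below e gives a supremum below e over some neighbourhood of
    infinity. *)
Lemma condS_tail (u : nat -> R) (r : nat -> nat) :
  condS N P X 1 r u -> forall e, 0 < e ->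
  \forall K \near \oo, \forall n \near \oo,
    (prob P (exceeds N X 0 (u n)))^-1 *
      \sum_(K <= i < (2 * r n).+1) i%:R * joint (u n) i <= e.
Proof.
move=> [_ /(_ 2)]; rewrite ltr1n => /(_ isT 1 1 ltr01 ltr01) hS e e0.
have e_nbhs : nbhs (0 : \bar R)%E [set x | (x < e%:E)%E].
  exact: (cvgr_lt (0 : R) cvg_id e e0 : \forall x \near (0 : R), x < e).
have [K0 _ hK0] := hS _ e_nbhs; exists K0 => // K /hK0.
rewrite /= /limn_esup limf_esupE => /ereal_inf_lt[_ [V Voo <-] Ve].
apply: filterS Voo => n Vn.
rewrite -lee_fin; apply: le_trans (ltW Ve); apply: ereal_sup_ubound.
exists n => //; congr (_ * _)%:E.
rewrite -natrM natrK; apply: eq_bigr => i _.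
by rewrite powRr1// mulr1.
Qed.

Lemma prob_exceeds_opp v (j : nat) :
  prob P (exceeds N X 0 v `&` exceeds N X (- j%:Z) v) = joint v j.
Proof.
have S0 : level_sigma N [set i | `|i| <= j%:Z]
    ([set x | v < N (x 0)] `&` [set x | v < N (x (- j%:Z))]).
  by apply: level_sigmaI; apply: level_sigma_gt => /=; lia.
have := stationary_level hN j%:Z hstat S0.
by rewrite /= add0r addNr /joint /prob /exceeds => <-; rewrite setIC.
Qed.

End cluster.

(** * Windows growing with n, seen from an exceedance at time 0 *)

Section anchored.
Context (R : realType) (d : nat) (N : 'rV[R]_d -> R) (hN : is_norm N)
  (dX : measure_display) (TX : measurableType dX) (P : probability TX R)
  (X : int -> TX -> 'rV[R]_d) (hX : is_process X) (hstat : stationary P X).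

Notation isolated := (isolated N P X).
Notation joint := (joint N P X).

Let mE j v : measurable (exceeds N X j v) := measurable_exceeds hN hX j v.
Let mB D v : measurable [set t | below N D v (X ^~ t)] := measurable_below hN hX D v.

Lemma isolated_mono (D D' : set int) v : D `<=` D' -> isolated D' v <= isolated D v.
Proof.
move=> DD'; apply: prob_mono; [exact: measurableI|exact: measurableI|].
by move=> t [? h]; split => // j /DD'; exact: h.
Qed.

(** The events differ only if there is an exceedance at some i with K < |i| <= M. A union bound over
    both signs gives the factor 2, as stationarity turns a negative lag into a positive one. *)
Lemma isolated_truncate (D : set int) v (K M : nat) :
  (forall j, D j -> `|j| <= M%:Z) ->
  `|isolated D v - isolated (D `&` [set j | `|j| <= K%:Z]) v|
    <= 2 * \sum_(K.+1 <= j < M.+1) joint v j.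
Proof.
move=> DM; rewrite distrC ger0_norm; last first.
  by rewrite subr_ge0; apply: isolated_mono; exact: subIsetl.
set DK := D `&` _.
rewrite /isolated (prob_split P (measurableI _ _ (mE 0 v) (mB DK v)) (mB D v)).
rewrite (_ : _ `&` _ `&` [set t | below N D v _] =
    exceeds N X 0 v `&` [set t | below N D v (X ^~ t)]); last first.
  apply/seteqP; split => t; first by case=> -[].
  by case=> ? h; split => //; split => // j [Dj _]; exact: h.
rewrite addrAC subrr add0r.
pose s := index_iota K.+1 M.+1.
have -> : 2 * \sum_(K.+1 <= j < M.+1) joint v j =
    \sum_(i <- [seq j%:Z | j <- s] ++ [seq - j%:Z | j <- s])
      prob P (exceeds N X 0 v `&` exceeds N X i v).
  rewrite big_cat !big_map/= [X in _ + X](_ : _ = \sum_(j <- s) joint v j).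
    by rewrite /s; ring.
  by apply: eq_bigr => j _; exact: prob_exceeds_opp.
apply: prob_le_sum.
- by apply: measurableI; [exact: measurableI|exact: measurableC].
- by move=> i; exact: measurableI.
move=> t [[E0 nDK] /= nD].
have [i [Di /negP]] : exists i, D i /\ ~ (N (X i t) <= v).
  by apply: contrapT => h; apply: nD => j Dj; apply: contrapT => ?; apply: h; exists j.
rewrite -ltNge => Ei.
have iM := DM _ Di.
have iK : K%:Z < `|i|.
  by rewrite ltNge; apply/negP => iK; have := nDK i (conj Di iK); rewrite leNgt Ei.
have is_ : i \in [seq j%:Z | j <- s] ++ [seq - j%:Z | j <- s].
  have As : absz i \in s by rewrite mem_index_iota; lia.
  rewrite mem_cat; have [i0|i0] := leP 0 i.
    by apply/orP; left; apply/mapP; exists (absz i) => //; lia.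
  by apply/orP; right; apply/mapP; exists (absz i) => //; lia.
by rewrite (big_rem i)//=; left.
Qed.

Context (alpha : R) (hRV : tail_index N P X alpha)
  (dY : measure_display) (TY : measurableType dY) (PY : probability TY R)
  (Y : int -> TY -> 'rV[R]_d) (hY : tail_process N P X PY Y)
  (u : nat -> R) (r : nat -> nat)
  (hu : u n @[n --> \oo] --> +oo) (hS : condS N P X 1 r u).

(** Given |X_0| > x, the window {0} is never below x, so its limit P(|Y_0| <= 1) is 0. Weak
    convergence by itself would only give |Y_0| >= 1 almost surely. *)
Lemma prob_tail_exceeds : prob PY (exceeds N Y 0 1) = 1.
Proof.
have h := @cvg_below_window _ _ N hN _ _ P X hX hstat alpha hRV _ _ PY Y hY [set 0] 0 0.
have {}h := h ltac:(by move=> j ->).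
have PY0 : prob PY [set t | below N [set 0] 1 (Y ^~ t)] = 0.
  suff h0 : prob P (exceeds N X 0 x `&` [set t | below N [set 0] x (X ^~ t)])
      / prob P (exceeds N X 0 x) @[x --> +oo] --> (0 : R).
    exact: cvg_unique h h0.
  apply: (@cvg_trans _ (nbhs ((fun _ : R => 0 : R) @ +oo))); last exact: cvg_cst.
  apply: near_eq_cvg; apply: nearW => x.
  rewrite (_ : _ `&` _ = set0) ?/prob ?measure0 ?mul0r//.
  apply/seteqP; split => t //= [+ /(_ 0 erefl)]; rewrite /exceeds/=; lra.
have [pY _] := hY.
have mE0 := measurable_exceeds hN pY 0 1.
have := prob_split PY measurableT mE0.
rewrite !setTI (_ : ~` _ = [set t | below N [set 0] 1 (Y ^~ t)]).
  by rewrite PY0 addr0 /prob probability_setT => <-.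
apply/seteqP; split => t; rewrite /exceeds/=.
  by move/negP; rewrite -leNgt => h0 j ->.
by move=> /(_ 0 erefl); rewrite leNgt => /negP.
Qed.

(** Truncation to |j| <= K costs little uniformly for large n, by condition S^(1). For fixed K the
    truncated window no longer changes with large n, so the finite-window limit applies; continuity
    from above then removes K. *)
Lemma cvg_isolated (D : nat -> set int) (Doo : set int) :
  (\forall n \near \oo, forall j, D n j -> `|j| <= (2 * r n)%N%:Z) ->
  (forall K : nat, \forall n \near \oo, forall j, `|j| <= K%:Z -> (D n j <-> Doo j)) ->
  isolated (D n) (u n) / prob P (exceeds N X 0 (u n)) @[n --> \oo] -->
  prob PY [set t | below N Doo 1 (Y ^~ t)].
Proof.
move=> Dr DDoo; have [tail0 _] := hRV.
pose trunc K := Doo `&` [set j | `|j| <= K%:Z].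
apply: (@cvg_approx _ _ (fun n K => isolated (trunc K) (u n) /
    prob P (exceeds N X 0 (u n)))
  (fun K => prob PY [set t | below N (trunc K) 1 (Y ^~ t)])).
(* Half of [e] absorbs the factor 2 of [isolated_truncate]. *)
- move=> e e0; have e2 : 0 < e / 2 by rewrite divr_gt0.
  have [K0 _ tailK] := condS_tail hS e2.
  exists K0 => // K /= K0K.
  have K0K1 : (K0 <= K.+1)%N by exact: leqW.
  near=> n.
  have tl : (prob P (exceeds N X 0 (u n)))^-1 *
      \sum_(K.+1 <= i < (2 * r n).+1) i%:R * joint (u n) i <= e / 2.
    by near: n; exact: (tailK K.+1 K0K1).
  have Dn : forall j, D n j -> `|j| <= (2 * r n)%N%:Z by near: n; exact: Dr.
  have DK : D n `&` [set j | `|j| <= K%:Z] = trunc K.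
    have h : forall j, `|j| <= K%:Z -> (D n j <-> Doo j) by near: n; exact: DDoo.
    by apply/seteqP; split => j [Dj jK]; split => //; apply/(h j jK).
  have pV : 0 < (prob P (exceeds N X 0 (u n)))^-1 by rewrite invr_gt0.
  rewrite -mulrBl normrM (gtr0_norm pV) -DK mulrC.
  rewrite (le_trans (ler_wpM2l (ltW pV) (isolated_truncate _ _ Dn)))//.
  (* All lags exceed K, hence are at least 1, so inserting the weight i only increases the sum. *)
  have joint_le : \sum_(K.+1 <= i < (2 * r n).+1) joint (u n) i <=
      \sum_(K.+1 <= i < (2 * r n).+1) i%:R * joint (u n) i.
    apply: ler_sum_nat => i /andP[Ki _].
    by rewrite ler_peMl ?joint_ge0// ler1n (leq_trans _ Ki).
  move/(ler_wpM2l (ltW pV)) : joint_le; rewrite mulrCA; lra.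
- move=> K; have window j : trunc K j -> - K%:Z <= j <= - K%:Z + (K + K)%N%:Z.
    by case=> _ /=; lia.
  have h := cvg_below_window hN hX hstat hRV hY window.
  exact: (cvg_comp _ _ hu h).
- have -> : [set t | below N Doo 1 (Y ^~ t)] =
      \bigcap_K [set t | below N (trunc K) 1 (Y ^~ t)].
    apply/seteqP; split => t /= h.
      by move=> K _ j [Dj _]; exact: h.
    by move=> j Dj; apply: (h (absz j)) => //; split => //=; lia.
  apply: cvg_prob_bigcap => [K|K K' KK' t h j [Dj jK]].
    by apply: measurable_below => //; exact: hY.1.
  by apply: h; split => //=; apply: le_trans jK _; rewrite lez_nat.
Unshelve. all: by end_near. Qed.

End anchored.

(** * Decomposition of the two-block event by its first exceedance *)

Section blocks.
Context (R : realType) (d : nat) (N : 'rV[R]_d -> R) (hN : is_norm N)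
  (dX : measure_display) (TX : measurableType dX) (P : probability TX R)
  (X : int -> TX -> 'rV[R]_d) (hX : is_process X) (hstat : stationary P X).

Notation isolated := (isolated N P X).
Notation joint := (joint N P X).

Let mE j v : measurable (exceeds N X j v) := measurable_exceeds hN hX j v.
Let mB D v : measurable [set t | below N D v (X ^~ t)] := measurable_below hN hX D v.

(** When time r + 1 - k of the first block is moved to 0, the earlier times of that block become
    [back r k] and the second block becomes [ahead r k]. *)
Definition back (r k : nat) : set int := [set j | k%:Z - r%:Z <= j <= -1].

Definition ahead (r k : nat) : set int := [set j | k%:Z <= j < k%:Z + r%:Z].

(** For v = u_n and r = r_n this is w_n a_n(k). *)
Definition straddle (v : R) (r k : nat) : R :=
  prob P (exceeds N X 0 v `&` [set t | below N (back r k) v (X ^~ t)] `&`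
    ~` [set t | below N (ahead r k) v (X ^~ t)]).

Lemma straddle_ge0 v r k : 0 <= straddle v r k.
Proof. exact: prob_ge0. Qed.

(** Brings [straddle] into the form treated by [cvg_isolated]. *)
Lemma straddleE v r k :
  straddle v r k = isolated (back r k) v - isolated (back r k `|` ahead r k) v.
Proof.
rewrite /isolated /straddle; set A := _ `&` [set t | below N (back r k) v _].
rewrite (_ : _ `&` [set t | below N (_ `|` _) v _] =
    A `&` [set t | below N (ahead r k) v (X ^~ t)]).
  rewrite (prob_split P (measurableI _ _ (mE 0 v) (mB _ v)) (mB (ahead r k) v)).
  by rewrite addrAC subrr add0r.
apply/seteqP; split => t.
  by case=> ? h; split; [split => // j ?|move=> j ?]; apply: h; [left|right].
by case=> -[? h1] h2; split => // j [/h1|/h2].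
Qed.

Lemma straddle_le v r k : straddle v r k <= \sum_(k <= j < k + r) joint v j.
Proof.
apply: prob_le_sum.
- by apply: measurableI; [exact: measurableI|exact: measurableC].
- by move=> j; exact: measurableI.
move=> t [[E0 _] /= nD].
have [i [Di /negP]] : exists i, ahead r k i /\ ~ (N (X i t) <= v).
  by apply: contrapT => h; apply: nD => j Dj; apply: contrapT => ?; apply: h; exists j.
rewrite -ltNge => Ei.
have is_ : absz i \in index_iota k (k + r).
  by move: Di; rewrite /ahead/= mem_index_iota; lia.
rewrite (big_rem (absz i))//=; left; split => //.
by rewrite (_ : (absz i)%:Z = i)//; move: Di; rewrite /ahead/=; lia.
Qed.

(** After the union bound and an exchange of sums, lag j is counted once for each k between K and
    min(r, j). As K >= 1 there are at most j of these, which is where the weight in S^(1) comes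
    from. *)
Lemma sum_straddle_le v r K : (0 < K)%N ->
  \sum_(K <= k < r.+1) straddle v r k
    <= \sum_(K <= j < (2 * r).+1) j%:R * joint v j.
Proof.
move=> K0; apply: (@le_trans _ _
  (\sum_(K <= k < r.+1) \sum_(K <= j < (2 * r).+1)
    if (k <= j)%N then joint v j else 0)).
  apply: ler_sum_nat => k /andP[Kk kr].
  apply: le_trans (straddle_le v r k) _.
  have h1 : (k <= k + r)%N by exact: leq_addr.
  have h2 : (k + r <= (2 * r).+1)%N by lia.
  have h3 : (k <= (2 * r).+1)%N by lia.
  rewrite [leRHS](big_cat_nat Kk h3)/= [X in _ <= _ + X](big_cat_nat h1 h2)/=.
  rewrite (_ : \sum_(k <= j < k + r) joint v j =
      \sum_(k <= j < k + r) if (k <= j)%N then joint v j else 0).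
    rewrite addrCA lerDl addr_ge0// sumr_ge0// => j _;
      by case: ifP => // _; exact: joint_ge0.
  by apply: eq_big_nat => j /andP[->].
rewrite exchange_big_nat/=; apply: ler_sum_nat => j _.
rewrite -big_mkcond/= big_const_seq iter_addr_0 mulr_natl.
apply: ler_wpMn2l; first exact: joint_ge0.
rewrite -size_filter -[leqRHS](size_iota 1).
apply: uniq_leq_size; first exact/filter_uniq/iota_uniq.
by move=> k; rewrite mem_filter mem_index_iota mem_iota; lia.
Qed.

(** Induction on the length: when time i + 1 is added, either an exceedance has occurred by time i,
    or the first one occurs at i + 1. *)
Lemma prob_first_exceedance v (D : set int) (i : nat) :
  prob P (~` [set t | below N [set j | 1 <= j <= i%:Z] v (X ^~ t)] `&`
      ~` [set t | below N D v (X ^~ t)]) =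
  \sum_(1 <= m < i.+1) prob P (exceeds N X m%:Z v `&`
    [set t | below N [set j | 1 <= j < m%:Z] v (X ^~ t)] `&`
    ~` [set t | below N D v (X ^~ t)]).
Proof.
have mC (A : set TX) : measurable A -> measurable (~` A) by exact: measurableC.
elim: i => [|i IH].
  rewrite big_geq// (_ : _ `&` _ = set0) ?/prob ?measure0//.
  by apply/seteqP; split => t //= -[+ _]; apply => j /=; lia.
rewrite big_nat_recr//= -IH.
rewrite (prob_split P (measurableI _ _ (mC _ (mB _ v)) (mC _ (mB D v)))
  (mC _ (mB [set j | 1 <= j <= i%:Z] v))).
congr (prob P _ + prob P _); apply/seteqP; split => t.
- by case=> -[? ?] ?.
- case=> h1 h2; split => //; split => // h; apply: h1 => j /= ji; apply: h => /=; lia.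
- rewrite setCK => -[[h1 h2] h3]; split => //; split; last first.
    by move=> j /= ji; apply: h3 => /=; lia.
  rewrite /exceeds/= ltNge; apply/negP => Xi; apply: h1 => j /= ji.
  have [->//|ji'] := eqVneq j i.+1%:Z.
  by apply: h3 => /=; lia.
- rewrite setCK => -[[h1 h3] h2]; split; last by move=> j /= ji; apply: h3 => /=; lia.
  split => // h; move: h1; rewrite /exceeds/= ltNge => /negP; apply; apply: h => /=; lia.
Qed.

Lemma straddle_shift v (r m : nat) : (0 < m <= r)%N ->
  prob P (exceeds N X m%:Z v `&`
    [set t | below N [set j | 1 <= j < m%:Z] v (X ^~ t)] `&`
    ~` [set t | below N [set j | r%:Z + 1 <= j <= 2 * r%:Z] v (X ^~ t)]) =
  straddle v r (r.+1 - m).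
Proof.
move=> /andP[m0 mr].
pose S : set int := [set j | `|j| <= (2 * r)%N%:Z].
have SC : level_sigma N S ([set x | v < N (x 0)] `&` below N (back r (r.+1 - m)) v
    `&` ~` below N (ahead r (r.+1 - m)) v).
  apply: level_sigmaI; first apply: level_sigmaI.
  - by apply: level_sigma_gt; rewrite /S/= normr0.
  - by apply: level_sigma_below => j; rewrite /S /back/=; lia.
  - by apply: level_sigmaC; apply: level_sigma_below => j; rewrite /S /ahead/=; lia.
rewrite /straddle /prob; congr fine.
have := stationary_level hN m%:Z hstat SC.
rewrite (_ : [set t | _ (X ^~ t)] = exceeds N X 0 v `&`
  [set t | below N (back r (r.+1 - m)) v (X ^~ t)] `&`
    ~` [set t | below N (ahead r (r.+1 - m)) v (X ^~ t)])// => <-.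
congr (P _); apply/seteqP; split => t.
- move=> [[h1 h2] h3]; split; first split.
  + by rewrite /= add0r.
  + by move=> j; rewrite /back/= => hj; apply: h2 => /=; lia.
  + move=> h; apply: h3 => j /= hj.
    by rewrite -(subrK m%:Z j); apply: h; rewrite /ahead/=; lia.
- move=> [[/= h1 h2] h3]; split; first split.
  + by move: h1; rewrite add0r.
  + by move=> j /= hj; rewrite -(subrK m%:Z j); apply: h2; rewrite /back/=; lia.
  + by move=> h; apply: h3 => j; rewrite /ahead/= => hj; apply: h => /=; lia.
Qed.

Lemma prob_block_exceeds (u : nat -> R) (r : nat -> nat) n :
  prob P (block_exceeds N X r u 1 n `&` block_exceeds N X r u 2 n) =
  \sum_(1 <= k < (r n).+1) straddle (u n) (r n) k.
Proof.
have blockE j : block_exceeds N X r u j n =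
    ~` [set t | below N [set l | (j - 1) * (r n)%:Z + 1 <= l <= j * (r n)%:Z]
      (u n) (X ^~ t)].
  apply/seteqP; split => t; rewrite /block_exceeds /max_norm/=.
    move=> /ereal_sup_gt[_ [l jl <-]]; rewrite lte_fin ltNge => /negP + h.
    by apply; exact: h.
  move=> h; apply: contrapT => h'; apply: h => l jl; rewrite leNgt; apply/negP => ul.
  apply: h'; apply: lt_le_trans (ereal_sup_ubound _); last by exists l.
  by rewrite lte_fin.
rewrite !blockE subrr mul0r add0r mul1r.
(* Reversing the sum replaces the time m of the first exceedance by k = r + 1 - m, its distance to
   the start of the second block. *)
rewrite prob_first_exceedance [RHS]big_nat_rev/=.
apply: eq_big_nat => m mr; rewrite straddle_shift//; congr (straddle _ _ _); lia.
Qed.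

Context (alpha : R) (hRV : tail_index N P X alpha)
  (dY : measure_display) (TY : measurableType dY) (PY : probability TY R)
  (Y : int -> TY -> 'rV[R]_d) (hY : tail_process N P X PY Y)
  (u : nat -> R) (r : nat -> nat)
  (hu : u n @[n --> \oo] --> +oo) (hr : r n @[n --> \oo] --> \oo)
  (hS : condS N P X 1 r u).

Definition past : set int := [set j | j <= -1].

Definition future (k : nat) : set int := [set j | k%:Z <= j].

Lemma cvg_straddle k :
  straddle (u n) (r n) k / prob P (exceeds N X 0 (u n)) @[n --> \oo] -->
  prob PY ([set t | below N past 1 (Y ^~ t)] `&`
    ~` [set t | below N (future k) 1 (Y ^~ t)]).
Proof.
have pY := hY.1.
have mY D : measurable [set t | below N D 1 (Y ^~ t)] by exact: measurable_below.
have -> : prob PY ([set t | below N past 1 (Y ^~ t)] `&`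
      ~` [set t | below N (future k) 1 (Y ^~ t)]) =
    prob PY [set t | below N past 1 (Y ^~ t)]
    - prob PY [set t | below N (past `|` future k) 1 (Y ^~ t)].
  rewrite (prob_split PY (mY past) (mY (future k))).
  rewrite (_ : [set t | below N (_ `|` _) 1 _] = [set t | below N past 1 (Y ^~ t)] `&`
    [set t | below N (future k) 1 (Y ^~ t)]); first by rewrite addrAC subrr add0r.
  apply/seteqP; split => t; first by move=> h; split => j ?; apply: h; [left|right].
  by case=> h1 h2 j [/h1|/h2].
have rbig M : \forall n \near \oo, (M <= r n)%N by exact: hr (nbhs_infty_ge M).
under eq_fun do rewrite straddleE mulrBl.
(* For fixed k, [ahead] stays within 2 r_n once r_n >= k, and the windows agree with their limits on
   |j| <= K once r_n >= k + K + 1. *)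
apply: cvgB; apply: (cvg_isolated hN hX hstat hRV hY hu hS) => [|K]; near=> n.
- by move=> j; rewrite /back/=; lia.
- have : (k + K <= r n)%N by near: n; exact: rbig.
  by move=> kr j jK; rewrite /back /past/=; split; lia.
- have : (k <= r n)%N by near: n; exact: rbig.
  by move=> kr j; rewrite /back /ahead/= => -[|]; lia.
- have : (k + K.+1 <= r n)%N by near: n; exact: rbig.
  move=> kr j jK; rewrite /back /past /future /ahead; split => -[/= h|/= h];
    [left|right|left|right]; rewrite /=; lia.
Unshelve. all: by end_near. Qed.

(** Tannery's theorem for the a_n(k), with tails controlled by [sum_straddle_le] and [condS_tail].
    The limit is finite and obtained as a series, to be identified later. *)
Lemma cvg_blocks : exists2 s : R,
  prob P (block_exceeds N X r u 1 n `&` block_exceeds N X r u 2 n)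
    / prob P (exceeds N X 0 (u n)) @[n --> \oo] --> s &
  \sum_(1 <= k < K) prob PY ([set t | below N past 1 (Y ^~ t)] `&`
    ~` [set t | below N (future k) 1 (Y ^~ t)]) @[K --> \oo] --> s.
Proof.
have sumE n : prob P (block_exceeds N X r u 1 n `&` block_exceeds N X r u 2 n)
    / prob P (exceeds N X 0 (u n)) = \sum_(1 <= k < (r n).+1)
      straddle (u n) (r n) k / prob P (exceeds N X 0 (u n)).
  by rewrite prob_block_exceeds mulr_suml.
rewrite (funext sumE).
apply: tannery => // [n k||e e0].
- by rewrite mulr_ge0 ?invr_ge0 ?straddle_ge0 ?prob_ge0.
- exact: cvg_straddle.
have tailS := condS_tail hS e0; near=> K.
have K0 : (0 < K)%N by near: K; exact: nbhs_infty_gt.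
have : \forall n \near \oo, (prob P (exceeds N X 0 (u n)))^-1 *
      \sum_(K <= i < (2 * r n).+1) i%:R * joint (u n) i <= e by near: K.
apply: filterS => n; apply: le_trans.
rewrite -mulr_suml mulrC; apply: ler_wpM2l; first by rewrite invr_ge0 prob_ge0.
exact: sum_straddle_le.
Unshelve. all: by end_near. Qed.

End blocks.

(** * The cluster length as a series of indicators, and its measurability *)

Section cluster_length.
Context (R : realType) (d : nat) (N : 'rV[R]_d -> R).

(** The first exceedance is at 0, so the left side is the supremum of the exceedance times. The
    series counts the k >= 0 with an exceedance at k + 1 or later, which gives the same value, +oo
    included. *)
Lemma cluster_length_series (x : int -> 'rV[R]_d) :
  below N past 1 x -> 1 < N (x 0) ->
  (cluster_length N x - 1 =
    \sum_(0 <= k <oo) (\1_(~` below N (future k.+1) 1) x)%:E)%E.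
Proof.
move=> xpast x0; rewrite /cluster_length.
set J := [set (j%:~R : R)%:E | j in _].
have J0 : J 0%E by exists 0.
have Jge0 j : 1 < N (x j) -> 0 <= j.
  by move=> xj; rewrite leNgt; apply/negP => j0;
    have := xpast j; rewrite /past/= (leNgt (N _)) xj => /(_ ltac:(lia)).
case: pselect => [J_0|J_N0] /=; first by move: J0; rewrite J_0.
have -> : ereal_inf J = 0%E.
  apply/eqP; rewrite eq_le; apply/andP; split; first exact: ereal_inf_lbound.
  apply: le_ereal_inf_tmp => _ [j /Jge0 j0 <-].
  by rewrite lee_fin ler0z.
rewrite sube0 addeK//.
pose c k : R := \1_(~` below N (future k.+1) 1) x.
have c01 k : 0 <= c k <= 1 by rewrite /c indicE; case: (_ \in _); rewrite ?lexx ler01.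
have c0 k : (0 <= (c k)%:E)%E by have /andP[] := c01 k; rewrite lee_fin.
have c1 k j : 1 < N (x j) -> k.+1%:Z <= j -> c k = 1.
  move=> xj kj; rewrite /c indicE mem_set//= => h.
  by have := h j kj; rewrite leNgt xj.
apply/eqP; rewrite eq_le; apply/andP; split.
  (* An exceedance at j makes the first j terms equal to 1. *)
  apply: ge_ereal_sup => _ [j xj <-]; have j0 := Jge0 _ xj.
  apply: le_trans (nneseries_lim_ge (absz j) _) => [|k _ _]; last exact: c0.
  rewrite sumEFin lee_fin (eq_big_nat _ _ (F2 := fun=> 1)).
    by rewrite sumr_const_nat subn0 pmulrn gez0_abs.
  by move=> k /andP[_ kj]; apply: (c1 k j) => //; lia.
apply: lime_le; first by apply: is_cvg_nneseries => k _ _; exact: c0.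
apply: nearW => n; rewrite sumEFin.
elim: n => [|n IH]; first by rewrite big_geq//; exact: ereal_sup_ubound.
rewrite big_nat_recr//=.
(* Either some exceedance time is at least n + 1, which bounds the n + 1 terms, or the last term is
   0 and the induction hypothesis suffices. *)
have [[j [nj xj]]|none] := pselect (exists j, n.+1%:Z <= j /\ 1 < N (x j)).
  apply: (@le_trans _ _ (j%:~R)%:E); last by apply: ereal_sup_ubound; exists j.
  rewrite lee_fin; apply: (@le_trans _ _ n.+1%:R); last first.
    by rewrite -[n.+1%:R]/(n.+1%:Z%:~R) ler_int.
  rewrite -big_nat_recr//=.
  have : \sum_(0 <= i < n.+1) c i <= \sum_(0 <= i < n.+1) 1.
    by apply: ler_sum => i _; have /andP[] := c01 i.
  by rewrite sumr_const_nat subn0.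
rewrite [X in _ + X](_ : _ = 0) ?addr0//.
rewrite indicE memNset//= => h; apply: h => j /= nj.
by rewrite leNgt; apply/negP => xj; apply: none; exists j.
Qed.

Lemma no_past_exceedanceE (dY : measure_display)
    (TY : measurableType dY) (Y : int -> TY -> 'rV[R]_d) :
  no_past_exceedance N Y = [set t | below N past 1 (Y ^~ t)].
Proof.
apply/seteqP; split => t; rewrite /no_past_exceedance /max_norm/=.
  by move=> /ereal_supP h j pj; rewrite -lee_fin; apply: h; exists j.
by move=> h; apply: ge_ereal_sup => _ [j pj <-]; rewrite lee_fin; exact: h.
Qed.

Context (hN : is_norm N).

(** The events that the supremum exceeds y, or that the infimum is below y, are countable unions
    over the exceedance time. *)
Lemma measurable_cluster_length (dT : measure_display) (T : measurableType dT)
    (Z : int -> T -> 'rV[R]_d) :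
  is_process Z -> measurable_fun setT (fun t => cluster_length N (Z ^~ t)).
Proof.
move=> hZ.
pose J t := [set (j%:~R : R)%:E | j in [set j : int | 1 < N (Z j t)]].
have mU (f : int -> Prop) :
    measurable [set t | exists j, f j /\ 1 < N (Z j t)].
  have -> : [set t | exists j, f j /\ 1 < N (Z j t)] =
      \bigcup_j [set t | f j /\ 1 < N (Z j t)].
    by apply/seteqP; split => t [j] => [h|_ h]; exists j.
  apply: countable_bigcupT_measurable => // j.
  have [fj|fj] := pselect (f j).
    rewrite (_ : mkset _ = exceeds N Z j 1); first exact: measurable_exceeds.
    by apply/seteqP; split => t; [case|split].
  by rewrite (_ : mkset _ = set0)//; apply/seteqP; split => t // -[].
have msup : measurable_fun setT (fun t => ereal_sup (J t)).
  apply: (measurability _ (ErealGenOInfty.measurableE R)) => // _ [_ [y ->] <-].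
  rewrite setTI [X in measurable X](_ : _ =
    [set t | exists j : int, (y < j%:~R) /\ 1 < N (Z j t)]); first exact: mU.
  apply/seteqP; split => t /=; rewrite in_itv/= andbT.
    by move=> /ereal_sup_gt[_ [j Zj <-]]; rewrite lte_fin => yj; exists j.
  move=> [j [yj Zj]]; apply: lt_le_trans (ereal_sup_ubound _); last by exists j.
  by rewrite lte_fin.
have minf : measurable_fun setT (fun t => ereal_inf (J t)).
  apply: (measurability _ (ErealGenInftyO.measurableE R)) => // _ [_ [y ->] <-].
  rewrite setTI [X in measurable X](_ : _ =
    [set t | exists j : int, (j%:~R < y) /\ 1 < N (Z j t)]); first exact: mU.
  apply/seteqP; split => t /=; rewrite in_itv/=.
    by move=> /ereal_inf_lt[_ [j Zj <-]]; rewrite lte_fin => yj; exists j.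
  move=> [j [yj Zj]]; apply: le_lt_trans (ereal_inf_lbound _) _; first by exists j.
  by rewrite lte_fin.
rewrite (_ : (fun t => _) = (fun t => if `[< J t = set0 >] then 0%E
    else (ereal_sup (J t) - ereal_inf (J t) + 1)%E)); last first.
  apply/funext => t; rewrite /cluster_length -/(J t).
  by case: pselect => Jt /=; rewrite ?(asboolT Jt) ?(asboolF Jt).
apply: measurable_fun_ifT.
- apply: (@measurable_fun_bool _ _ _ _ true); rewrite setTI.
  rewrite (_ : _ @^-1` _ = [set t | below N setT 1 (Z ^~ t)]).
    exact: measurable_below.
  apply/seteqP; split => t /=.
    move/asboolP => Jt j _; rewrite leNgt; apply/negP => Zj.
    by have : J t (j%:~R)%:E by [exists j]; rewrite Jt.
  move=> h; apply/asboolP/seteqP; split => // _ [j /= Zj _].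
  by have := h j I; rewrite leNgt Zj.
- exact: measurable_cst.
- apply: emeasurable_funD => //; exact: emeasurable_funB.
Qed.

End cluster_length.

(** * Identification of the series with theta E[L(Z) - 1] *)

Theorem corollary5p3p2 (R : realType) (d : nat) (hd : (0 < d)%N)
    (N : 'rV[R]_d -> R) (hN : is_norm N)
    (dX : measure_display) (TX : measurableType dX) (P : probability TX R)
    (X : int -> TX -> 'rV[R]_d)
    (hX : is_process X) (hstat : stationary P X)
    (alpha : R) (halpha : 0 < alpha) (hRV : tail_index N P X alpha)
    (dY : measure_display) (TY : measurableType dY) (PY : probability TY R)
    (Y : int -> TY -> 'rV[R]_d) (hY : tail_process N P X PY Y)
    (dZ : measure_display) (TZ : measurableType dZ) (PZ : probability TZ R)
    (Z : int -> TZ -> 'rV[R]_d) (hZ : conditioned_tail_process N PY Y PZ Z)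
    (u : nat -> R) (r : nat -> nat) (w : nat -> R)
    (hw : forall n, w n = prob P (exceeds N X 0 (u n)))
    (hu0 : forall n, 0 < u n)
    (hu : u n @[n --> \oo] --> +oo)
    (hr : r n @[n --> \oo] --> \oo)
    (hnw : n%:R * w n @[n --> \oo] --> +oo)
    (hrn : (r n)%:R / n%:R @[n --> \oo] --> (0 : R))
    (hrw : (r n)%:R * w n @[n --> \oo] --> (0 : R))
    (hS : condS N P X 1 r u) :
  (prob P (block_exceeds N X r u 1 n `&` block_exceeds N X r u 2 n) / w n)%:E
    @[n --> \oo] -->
  ((theta N PY Y)%:E * \int[PZ]_t (cluster_length N (Z ^~ t) - 1))%E.
Proof.
have [s cvg_s cvg_b] := cvg_blocks hN hX hstat hRV hY hu hr hS.
suff -> : ((theta N PY Y)%:E * \int[PZ]_t (cluster_length N (Z ^~ t) - 1) = s%:E)%E.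
  apply: cvg_EFin; first exact: nearW.
  by apply: cvg_trans cvg_s; apply: near_eq_cvg; apply: nearW => n /=; rewrite hw.
have pY := hY.1; have [pZ law_Z] := hZ.
have mY D : measurable [set t | below N D 1 (Y ^~ t)] by exact: measurable_below.
have mZ D : measurable [set t | below N D 1 (Z ^~ t)] by exact: measurable_below.
have thetaE : theta N PY Y = prob PY [set t | below N past 1 (Y ^~ t)].
  by rewrite /theta no_past_exceedanceE.
pose b k := prob PY ([set t | below N past 1 (Y ^~ t)] `&`
  ~` [set t | below N (future k) 1 (Y ^~ t)]).
rewrite -[X in X @ \oo --> _]/(fun K => \sum_(1 <= k < K) b k) in cvg_b.
have law_future k :
    theta N PY Y * prob PZ (~` [set t | below N (future k) 1 (Z ^~ t)]) = b k.
  have mC : path_measurable (~` below N (future k) 1).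
    have : level_sigma N setT (~` below N (future k) 1).
      by apply: level_sigmaC; exact: level_sigma_below.
    exact: path_measurable_level.
  by rewrite /b setIC -no_past_exceedanceE; exact: law_Z mC.
(* If theta = 0, the law of Z is not determined, but the product is 0 by the convention 0 * x = 0 in
   the extended reals, and s = 0 since every [b k] vanishes. *)
have [theta0|theta0] := eqVneq (theta N PY Y) 0.
  rewrite theta0 mul0e; congr EFin.
  have b0 k : b k = 0 by rewrite -law_future theta0 mul0r.
  have b_sum : (fun K => \sum_(1 <= k < K) b k) = fun=> 0.
    by apply/funext => K; rewrite big1.
  rewrite b_sum in cvg_b; exact: cvg_unique (cvg_cst (0 : R)) cvg_b.
(* The event on which [cluster_length_series] applies to Z. It has probability 1 because |Y_0| > 1
   almost surely and the conditioning event is that on the past. *)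
pose good := exceeds N Z 0 1 `&` [set t | below N past 1 (Z ^~ t)].
have mgood : measurable good.
  by apply: measurableI => //; exact: measurable_exceeds.
have PZgood : prob PZ good = 1.
  have mC : path_measurable ([set x | 1 < N (x 0)] `&` below N past 1).
    suff : level_sigma N setT ([set x | 1 < N (x 0)] `&` below N past 1).
      exact: path_measurable_level.
    by apply: level_sigmaI; [exact: level_sigma_gt|exact: level_sigma_below].
  apply: (mulfI theta0); rewrite mulr1; apply: etrans (law_Z _ mC) _.
  rewrite no_past_exceedanceE thetaE.
  have mE := measurable_exceeds hN pY 0 1.
  rewrite [RHS](prob_split PY (mY past) mE).
  rewrite [X in _ + X](_ : _ = 0) ?addr0.
    by congr prob; apply/seteqP; split => t; [case=> -[]|case=> ? ?; split].
  apply/eqP; rewrite eq_le prob_ge0 andbT.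
  have := prob_tail_exceeds hN hX hstat hRV hY.
  have := prob_split PY measurableT mE; rewrite !setTI => + Y1.
  rewrite Y1 {1}/prob probability_setT /= => h.
  have -> : 0 = prob PY (~` exceeds N Y 0 1) by move: h; lra.
  apply: prob_mono; [|exact: measurableC|exact: subIsetr].
  by apply: measurableI => //; exact: measurableC.
pose c k t : R := \1_(~` [set t | below N (future k.+1) 1 (Z ^~ t)]) t.
have -> : (\int[PZ]_t (cluster_length N (Z ^~ t) - 1) =
    \int[PZ]_t \sum_(0 <= k <oo) (c k t)%:E)%E.
  apply: ae_eq_integral => //.
  - by apply: emeasurable_funB => //; exact: measurable_cluster_length.
  - apply: ge0_emeasurable_sum => k.
      by move=> t _ _; rewrite lee_fin.
    by move=> _; apply/measurable_EFinP; apply: measurable_indic; exact: measurableC.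
  exists (~` good); split.
  - exact: measurableC.
  - have := prob_split PZ measurableT mgood.
    rewrite !setTI PZgood {1}/prob probability_setT/= -prob_EFin; last exact: measurableC.
    by move=> h; congr EFin; lra.
  - move=> t /= h [gt pt]; apply: h => _.
    exact: cluster_length_series.
(* The terms are nonnegative, so sum and expectation commute. *)
rewrite integral_nneseries//; last 2 first.
- by move=> k; apply/measurable_EFinP; apply: measurable_indic; exact: measurableC.
- by move=> k t _; rewrite lee_fin.
rewrite -nneseriesZl; last by move=> k _; apply: integral_ge0 => t _; rewrite lee_fin.
have int_c k : ((theta N PY Y)%:E * \int[PZ]_t (c k t)%:E = (b k.+1)%:E)%E.
  have mC := measurableC (mZ (future k.+1)).
  rewrite integral_indic// setIT -(law_future k.+1) EFinM; congr (_ * _)%E.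
  by rewrite prob_EFin.
under eq_eseriesr do rewrite int_c.
apply/cvg_lim => //; apply: cvg_EFin; first by apply: nearW => n; rewrite sumEFin.
(* The first n terms [b k.+1] form the sum of [b k] over 1 <= k < n + 1, hence the shift by one. *)
apply: cvg_trans (cvg_comp _ _ (cvg_addnr 1) cvg_b).
apply: near_eq_cvg; apply: nearW => n /=.
by rewrite addn1 big_add1 sumEFin.
Qed.
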